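(* Let $q\in\mathbb{C}$ be nonzero and let $\Lambda_1=\mathrm{diag}(\lambda_0,\lambda_1)$ with $\lambda_0,\lambda_1\in\mathbb{C}$ nonzero. The representation $\sigma^\Lambda(q,1)$ of $B_3$ in $\mathbb{C}^2$ is subspace irreducible if and only if $\Lambda_1$ is not of the form $\lambda_0\,\mathrm{diag}(1,\alpha)$ with $\alpha^2-\alpha+1=0$.
   Context: $B_3=\langle\sigma_1,\sigma_2\mid\sigma_1\sigma_2\sigma_1=\sigma_2\sigma_1\sigma_2\rangle$. The representation $\sigma^\Lambda(q,n)$ is in general $\sigma_1\mapsto\sigma_1(q,n)D_n^\sharp(q)\Lambda_n$, $\sigma_2\mapsto\Lambda_n^\sharp D_n(q)\sigma_2(q,n)$; for $n=1$ it does not depend on $q$ and is $$\sigma_1\mapsto\begin{pmatrix}1&1\\0&1\end{pmatrix}\begin{pmatrix}\lambda_0&0\\0&\lambda_1\end{pmatrix}=\begin{pmatrix}\lambda_0&\lambda_1\\0&\lambda_1\end{pmatrix},\qquad \sigma_2\mapsto\begin{pmatrix}\lambda_1&0\\0&\lambda_0\end{pmatrix}\begin{pmatrix}1&0\\-1&1\end{pmatrix}=\begin{pmatrix}\lambda_1&0\\-\lambda_0&\lambda_0\end{pmatrix}.$$ A representation is subspace irreducible if there is no nontrivial subspace invariant under all operators of the representation. *)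

(* Defs.v *)
From HB Require Import structures.
From mathcomp Require Import all_boot all_order all_algebra.
From mathcomp Require Import generic_quotient.
From mathcomp Require Import boolp reals.
From mathcomp Require Import complex.
From mathcomp Require Import ring.

Set Implicit Arguments.
Unset Strict Implicit.
Unset Printing Implicit Defensive.

Import GRing.Theory.

Local Open Scope ring_scope.
Local Open Scope quotient_scope.

(* A letter (i, e) is the generator sigma_1 (i = false) or sigma_2 (i = true),
   inverted when e = true. *)
Definition letter : Type := (bool * bool)%type.
Definition word : Type := seq letter.

Definition inv_letter (x : letter) : letter := (x.1, ~~ x.2).
Definition inv_word (w : word) : word := rev (map inv_letter w).

Definition letter1 : letter := (false, false).
Definition letter2 : letter := (true, false).

Inductive braid_eq : word -> word -> Prop :=
| braid_refl w : braid_eq w w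
| braid_sym w1 w2 : braid_eq w1 w2 -> braid_eq w2 w1
| braid_trans w1 w2 w3 : braid_eq w1 w2 -> braid_eq w2 w3 -> braid_eq w1 w3
| braid_cat w1 w2 w3 w4 :
    braid_eq w1 w2 -> braid_eq w3 w4 -> braid_eq (w1 ++ w3) (w2 ++ w4)
| braid_cancel x : braid_eq [:: x; inv_letter x] [::]
| braid_relation :
    braid_eq [:: letter1; letter2; letter1] [:: letter2; letter1; letter2].

Definition braid_eqb : rel word := fun w1 w2 => `[< braid_eq w1 w2 >].

Lemma braid_eqb_refl : reflexive braid_eqb.
Proof. by move=> w; apply/asboolP; exact: braid_refl. Qed.

Lemma braid_eqb_sym : symmetric braid_eqb.
Proof. by move=> v w; apply/asboolP/asboolP; exact: braid_sym. Qed.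

Lemma braid_eqb_trans : transitive braid_eqb.
Proof.
by move=> v u w /asboolP uv /asboolP vw; apply/asboolP; exact: braid_trans vw.
Qed.

Canonical braid_equiv :=
  EquivRel braid_eqb braid_eqb_refl braid_eqb_sym braid_eqb_trans.

Definition B3 : Type := {eq_quot braid_equiv}.

HB.instance Definition _ := Choice.copy B3 {eq_quot braid_equiv}.


Lemma pi_B3P (v w : word) : \pi_B3 v = \pi_B3 w <-> braid_eq v w.
Proof.
split=> [/eqP|vw]; first by rewrite eqmodE => /asboolP.
by apply/eqP; rewrite eqmodE; apply/asboolP.
Qed.

Lemma repr_B3P (w : word) : braid_eq (repr (\pi_B3 w)) w.
Proof. by apply/pi_B3P; rewrite reprK. Qed.

Lemma inv_letterK : involutive inv_letter.
Proof. by case=> i e; rewrite /inv_letter /= negbK. Qed.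

Lemma inv_wordK : involutive inv_word.
Proof. by move=> w; rewrite /inv_word map_rev revK mapK //; exact: inv_letterK. Qed.

Lemma inv_word_cat (v w : word) : inv_word (v ++ w) = inv_word w ++ inv_word v.
Proof. by rewrite /inv_word map_cat rev_cat. Qed.

Lemma braid_eq_mulV (w : word) : braid_eq (w ++ inv_word w) [::].
Proof.
elim: w => [|x w IH]; first exact: braid_refl.
rewrite -[x :: w]cat1s inv_word_cat -catA (catA w).
apply: braid_trans (braid_cancel x).
apply: (braid_cat (braid_refl [:: x])).
exact: (braid_cat IH (braid_refl [:: inv_letter x])).
Qed.

Lemma braid_eq_Vmul (w : word) : braid_eq (inv_word w ++ w) [::].
Proof. by rewrite -{2}[w]inv_wordK; exact: braid_eq_mulV. Qed.

Lemma braid_eq_inv (v w : word) :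
  braid_eq v w -> braid_eq (inv_word v) (inv_word w).
Proof.
move=> vw; apply: (@braid_trans _ (inv_word v ++ (w ++ inv_word w))).
  rewrite -{1}[inv_word v]cats0; apply: braid_cat; first exact: braid_refl.
  exact/braid_sym/braid_eq_mulV.
rewrite catA -[inv_word w in X in braid_eq _ X]cat0s.
apply: braid_cat (braid_refl _).
apply: braid_trans (braid_eq_Vmul v).
exact: braid_cat (braid_refl _) (braid_sym vw).
Qed.

Definition B3_one : B3 := \pi_B3 [::].
Definition B3_mul (x y : B3) : B3 := \pi_B3 (repr x ++ repr y).
Definition B3_inv (x : B3) : B3 := \pi_B3 (inv_word (repr x)).

Lemma B3_mul_pi (v w : word) : B3_mul (\pi_B3 v) (\pi_B3 w) = \pi_B3 (v ++ w).
Proof. by apply/pi_B3P; apply: braid_cat; exact: repr_B3P. Qed.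

Lemma B3_inv_pi (w : word) : B3_inv (\pi_B3 w) = \pi_B3 (inv_word w).
Proof. by apply/pi_B3P; apply: braid_eq_inv; exact: repr_B3P. Qed.

Lemma B3_mulA : associative B3_mul.
Proof.
elim/quotW=> x; elim/quotW=> y; elim/quotW=> z.
by rewrite (B3_mul_pi y) B3_mul_pi (B3_mul_pi x) B3_mul_pi catA.
Qed.

Lemma B3_mul1 : left_id B3_one B3_mul.
Proof. by elim/quotW=> x; rewrite B3_mul_pi. Qed.

Lemma B3_mulr1 : right_id B3_one B3_mul.
Proof. by elim/quotW=> x; rewrite B3_mul_pi cats0. Qed.

Lemma B3_mulV : left_inverse B3_one B3_inv B3_mul.
Proof.
elim/quotW=> x; rewrite B3_inv_pi B3_mul_pi.
by apply/pi_B3P; exact: braid_eq_Vmul.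
Qed.

Lemma B3_mulrV : right_inverse B3_one B3_inv B3_mul.
Proof.
elim/quotW=> x; rewrite B3_inv_pi B3_mul_pi.
by apply/pi_B3P; exact: braid_eq_mulV.
Qed.

HB.instance Definition _ :=
  isGroup.Build B3 B3_mulA B3_mul1 B3_mulr1 B3_mulV B3_mulrV.

Definition sigma1 : B3 := \pi_B3 [:: letter1].
Definition sigma2 : B3 := \pi_B3 [:: letter2].

Lemma B3_braid :
  (sigma1 * sigma2 * sigma1 = sigma2 * sigma1 * sigma2)%g.
Proof.
have M v w : ((\pi_B3 v : B3) * (\pi_B3 w : B3))%g = \pi_B3 (v ++ w) :> B3 := B3_mul_pi v w.
rewrite /sigma1 /sigma2 M M M M.
by apply/pi_B3P; exact: braid_relation.
Qed.

Record representation (G : groupType) (K : fieldType) (n : nat) := Representation {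
  rep_mx :> G -> 'M[K]_n;
  rep_mx1 : rep_mx 1%g = 1%:M;
  rep_mxM : forall g h : G, rep_mx (g * h)%g = rep_mx g *m rep_mx h
}.

Definition subspace_irreducible (G : groupType) (K : fieldType) (n : nat)
    (rho : representation G K n) : Prop :=
  forall U : {vspace 'cV[K]_n},
    (forall (g : G) (v : 'cV[K]_n), v \in U -> rho g *m v \in U) ->
    U = 0%VS \/ U = fullv.

Section BraidRepresentation.
Variables (K : fieldType) (n : nat) (A1 A2 : 'M[K]_n).

Definition letter_mx (x : letter) : 'M[K]_n :=
  let A := if x.1 then A2 else A1 in if x.2 then invmx A else A.

Definition word_mx (w : word) : 'M[K]_n :=
  foldr (fun x M => letter_mx x *m M) 1%:M w.

Hypotheses (A1u : A1 \in unitmx) (A2u : A2 \in unitmx).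
Hypothesis A12 : A1 *m A2 *m A1 = A2 *m A1 *m A2.

Lemma word_mx_cat (v w : word) : word_mx (v ++ w) = word_mx v *m word_mx w.
Proof. by elim: v => [|x v IH] /=; rewrite ?mul1mx // IH mulmxA. Qed.

Lemma word_mx_eq (v w : word) : braid_eq v w -> word_mx v = word_mx w.
Proof.
elim=> {v w} //= [v w u _ -> _ -> //|v w v' w' _ e _ e'|[[] []]|].
- by rewrite !word_mx_cat e e'.
- by rewrite /letter_mx /= mulmx1 mulVmx.
- by rewrite /letter_mx /= mulmx1 mulmxV.
- by rewrite /letter_mx /= mulmx1 mulVmx.
- by rewrite /letter_mx /= mulmx1 mulmxV.
- by rewrite /letter_mx /= !mulmx1 !mulmxA.
Qed.

Lemma word_mx_pi (w : word) : word_mx (repr (\pi_B3 w)) = word_mx w.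
Proof. exact: word_mx_eq (repr_B3P w). Qed.

Lemma B3_mx1 : word_mx (repr (1%g : B3)) = 1%:M.
Proof. exact: (word_mx_pi [::]). Qed.

Lemma B3_mxM (g h : B3) :
  word_mx (repr (g * h)%g) = word_mx (repr g) *m word_mx (repr h).
Proof. by rewrite -word_mx_cat; exact: word_mx_pi. Qed.

Definition B3_rep : representation B3 K n :=
  @Representation B3 K n (fun g => word_mx (repr g)) B3_mx1 B3_mxM.

Lemma B3_rep_sigma1 : B3_rep sigma1 = A1.
Proof. by rewrite /= word_mx_pi /= mulmx1. Qed.

Lemma B3_rep_sigma2 : B3_rep sigma2 = A2.
Proof. by rewrite /= word_mx_pi /= mulmx1. Qed.

End BraidRepresentation.

Definition mx2 (K : nzRingType) (a b c d : K) : 'M[K]_2 :=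
  \matrix_(i < 2, j < 2)
    if i == 0 then (if j == 0 then a else b) else (if j == 0 then c else d).

Definition diag2 (K : nzRingType) (a b : K) : 'M[K]_2 := mx2 a 0 0 b.

Lemma mul_mx2 (K : nzRingType) (a b c d a' b' c' d' : K) :
  mx2 a b c d *m mx2 a' b' c' d' =
  mx2 (a * a' + b * c') (a * b' + b * d') (c * a' + d * c') (c * b' + d * d').
Proof.
apply/matrixP => i j; rewrite !mxE big_ord_recl big_ord1 !mxE /=.
by case: (i == 0); case: (j == 0).
Qed.

Lemma det_mx2 (K : comNzRingType) (a b c d : K) :
  \det (mx2 a b c d) = a * d - b * c.
Proof.
rewrite (expand_det_row _ ord0) big_ord_recl big_ord1 /cofactor !det_mx11 !mxE /=.
by rewrite expr0 expr1 mul1r mulN1r mulrN.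
Qed.

Section SigmaLambda.
Variables (K : fieldType) (l0 l1 : K).

Definition sigma1_mx : 'M[K]_2 := mx2 1 1 0 1 *m diag2 l0 l1.
Definition sigma2_mx : 'M[K]_2 := diag2 l1 l0 *m mx2 1 0 (-1) 1.

Lemma sigma1_mxE : sigma1_mx = mx2 l0 l1 0 l1.
Proof. by rewrite /sigma1_mx /diag2 mul_mx2 !(mul1r, mul0r, mulr0, addr0, add0r). Qed.

Lemma sigma2_mxE : sigma2_mx = mx2 l1 0 (- l0) l0.
Proof.
by rewrite /sigma2_mx /diag2 mul_mx2 !(mulr1, mul0r, mulr0, addr0, add0r, mulrN1).
Qed.

Lemma sigma_mx_braid :
  sigma1_mx *m sigma2_mx *m sigma1_mx = sigma2_mx *m sigma1_mx *m sigma2_mx.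
Proof. by rewrite sigma1_mxE sigma2_mxE !mul_mx2; congr mx2; ring. Qed.

Hypotheses (l0_neq0 : l0 != 0) (l1_neq0 : l1 != 0).

Lemma sigma1_mx_unit : sigma1_mx \in unitmx.
Proof.
by rewrite unitmxE sigma1_mxE det_mx2 mulr0 subr0 unitfE mulf_neq0.
Qed.

Lemma sigma2_mx_unit : sigma2_mx \in unitmx.
Proof.
by rewrite unitmxE sigma2_mxE det_mx2 mul0r subr0 unitfE mulf_neq0.
Qed.

(* The case n = 1 of the representations
     sigma_1 |-> sigma_1(q, n) D_n^sharp(q) Lambda_n,
     sigma_2 |-> Lambda_n^sharp D_n(q) sigma_2(q, n);
   for n = 1 the matrices do not depend on q, hence q does not occur in the
   body. *)
Definition sigma_Lambda (q : K) : representation B3 K 2 :=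
  B3_rep sigma1_mx_unit sigma2_mx_unit sigma_mx_braid.

Lemma sigma_Lambda_sigma1 (q : K) : sigma_Lambda q sigma1 = mx2 l0 l1 0 l1.
Proof. by rewrite B3_rep_sigma1 sigma1_mxE. Qed.

Lemma sigma_Lambda_sigma2 (q : K) : sigma_Lambda q sigma2 = mx2 l1 0 (- l0) l0.
Proof. by rewrite B3_rep_sigma2 sigma2_mxE. Qed.

End SigmaLambda.

(* Main.v *)
(** Both generators act on [(l1, l1 - l0)] as [l1], up to the obstruction
    [l1 ^+ 2 - l0 * l1 + l0 ^+ 2] for sigma_2; comparing the eigenvectors of the
    two generators shows that a common one exists only when this obstruction
    vanishes. A proper nonzero subspace of a plane is a line, hence spanned by
    such a common eigenvector, and [alpha = l1 / l0] normalises the equation. *)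
Require Import Defs.
From mathcomp Require Import all_boot all_order all_algebra.
From mathcomp Require Import reals complex.
From mathcomp Require Import ring.

Import GRing.Theory.
Local Open Scope ring_scope.

(** Induction on a word representing [g]: each letter scales [v], an inverted one by the inverse
    eigenvalue, whence [c1] and [c2] nonzero. So invariance of the line through [v] need only be
    tested on the generators. *)
Lemma B3_rep_eigenvector (K : fieldType) (n : nat) (A1 A2 : 'M[K]_n)
    (A1u : A1 \in unitmx) (A2u : A2 \in unitmx)
    (A12 : A1 *m A2 *m A1 = A2 *m A1 *m A2) (v : 'cV[K]_n) (c1 c2 : K) :
  c1 != 0 -> c2 != 0 -> A1 *m v = c1 *: v -> A2 *m v = c2 *: v ->
  forall g : B3, exists c, B3_rep A1u A2u A12 g *m v = c *: v.
Proof.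
move=> c1N0 c2N0 A1v A2v g /=; elim: (repr g) => [|x w [c IH]] /=.
  by exists 1; rewrite mul1mx scale1r.
have inv_eigen (A : 'M[K]_n) a :
    A \in unitmx -> a != 0 -> A *m v = a *: v -> invmx A *m v = a^-1 *: v.
  move=> Au aN0 Av; apply: (scalerI aN0).
  by rewrite scalemxAr -Av mulKmx // scalerA divff // scale1r.
have [a xv] : exists a, letter_mx A1 A2 x *m v = a *: v.
  by case: x => [[] []]; rewrite /letter_mx /=; eexists; eauto.
by exists (c * a); rewrite -mulmxA IH -scalemxAr xv scalerA.
Qed.

Definition col2 (K : fieldType) (x y : K) : 'cV[K]_2 :=
  \col_i (if i == 0 then x else y).

Lemma col2E (K : fieldType) (v : 'cV[K]_2) : v = col2 K (v 0 0) (v 1 0).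
Proof.
by apply/colP; case=> [[|[|//]] i2]; rewrite !mxE /=; congr (v _ _); apply: val_inj.
Qed.

Lemma col2_inj (K : fieldType) (x y x' y' : K) :
  col2 K x y = col2 K x' y' -> x = x' /\ y = y'.
Proof. by move/colP=> e; move: (e 0) (e 1); rewrite !mxE /=. Qed.

Lemma scale_col2 (K : fieldType) (a x y : K) :
  a *: col2 K x y = col2 K (a * x) (a * y).
Proof. by apply/colP => i; rewrite !mxE; case: ifP. Qed.

Lemma mul_mx2_col2 (K : fieldType) (a b c d x y : K) :
  mx2 a b c d *m col2 K x y = col2 K (a * x + b * y) (c * x + d * y).
Proof.
apply/colP => i; rewrite !mxE big_ord_recl big_ord1 !mxE /=.
by case: (i == 0).
Qed.

Lemma sigma_common_eigenvector (K : fieldType) (l0 l1 c d : K) (v : 'cV[K]_2) :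
  l0 != 0 -> l1 != 0 -> v != 0 ->
  mx2 l0 l1 0 l1 *m v = c *: v -> mx2 l1 0 (- l0) l0 *m v = d *: v ->
  l1 ^+ 2 - l0 * l1 + l0 ^+ 2 = 0.
Proof.
move=> l0N0 l1N0; rewrite (col2E K v); move: (v 0 0) (v 1 0) => x y vN0.
rewrite !mul_mx2_col2 !scale_col2 !mul0r !add0r addr0.
move=> /(@col2_inj K)[e1 e2] /(@col2_inj K)[e3 e4].
have xy0 : ~ (x = 0 /\ y = 0).
  move=> [x0 y0]; case/eqP: vN0; apply/colP => i; rewrite !mxE x0 y0.
  by case: ifP.
(* Triangularity makes each coordinate axis an eigenline of only one generator, so a common
   eigenvector lies on neither axis. *)
have yN0 : y != 0.
  apply/eqP => y0; apply: xy0; split=> //; move: e4.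
  by rewrite y0 !mulr0 addr0 => /eqP; rewrite mulf_eq0 oppr_eq0 (negPf l0N0) => /eqP.
have xN0 : x != 0.
  apply/eqP => x0; apply: xy0; split=> //; move: e1.
  by rewrite x0 !mulr0 add0r => /eqP; rewrite mulf_eq0 (negPf l1N0) => /eqP.
(* Cancelling [y] in [e2] and [x] in [e3] forces both eigenvalues to be [l1]. *)
move/(mulIf yN0): e2 e1 => <- e1; move/(mulIf xN0): e3 e4 => <- e4.
apply: (mulIf yN0); rewrite mul0r.
(* The weights [l0] and [l0 - l1] eliminate [x] from [e1] and [e4]; the coefficient left on [y] is
   the determinant of this linear system. *)
have -> : (l1 ^+ 2 - l0 * l1 + l0 ^+ 2) * y =
  l0 * (l0 * x + l1 * y - l1 * x)
  + (l0 - l1) * (- l0 * x + l0 * y - l1 * y) by ring.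
by rewrite e1 e4 !subrr !mulr0 addr0.
Qed.

Lemma sigma_Lambda_irreducibleP (K : fieldType) (q l0 l1 : K)
    (l0_neq0 : l0 != 0) (l1_neq0 : l1 != 0) :
  subspace_irreducible (sigma_Lambda l0_neq0 l1_neq0 q) <->
  l1 ^+ 2 - l0 * l1 + l0 ^+ 2 <> 0.
Proof.
have dim2 : \dim (fullv : {vspace 'cV[K]_2}) = 2 by rewrite dimvf.
split=> [irr e | ne U Uinv].
  (* This vector spans the kernel of [sigma1_mx l0 l1 - l1%:M]; its first coordinate shows that it
     is nonzero. *)
  pose v := col2 K l1 (l1 - l0).
  have vN0 : v != 0.
    by apply/eqP => /colP/(_ 0); rewrite !mxE /=; apply/eqP.
  have s1v : sigma1_mx l0 l1 *m v = l1 *: v.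
    by rewrite sigma1_mxE mul_mx2_col2 scale_col2; congr col2; ring.
  have s2v : sigma2_mx l0 l1 *m v = l1 *: v.
    rewrite sigma2_mxE mul_mx2_col2 scale_col2; congr col2; first by ring.
    (* The two sides differ by exactly the polynomial that [e] sets to zero. *)
    by apply/esym/eqP; rewrite -subr_eq0 -e; apply/eqP; ring.
  case: (irr <[v]>%VS) => [g u /vlineP[a ->]|U0|Uf].
  - have [c gv] := B3_rep_eigenvector _ _ _ _ (sigma1_mx_unit l0_neq0 l1_neq0)
      (sigma2_mx_unit l0_neq0 l1_neq0) (sigma_mx_braid l0 l1) v _ _
      l1_neq0 l1_neq0 s1v s2v g.
    by rewrite -scalemxAr gv !memvZ // memv_line.
  - by have := dim_vline v; rewrite U0 dimv0 vN0.
  - by have := dim_vline v; rewrite Uf dim2 vN0.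
have [->|UN0] := eqVneq U 0%VS; first by left.
right; apply/eqP; rewrite eqEdim subvf dim2 leqNgt; apply/negP => dimU.
have vN0 : vpick U != 0 by rewrite vpick0.
(* Since [U] has dimension below 2, it is the line through any of its nonzero vectors, so invariance
   turns that vector into a common eigenvector. *)
have vU : U = <[vpick U]>%VS.
  apply/esym/eqP; rewrite eqEdim -memvE memv_pick dim_vline vN0.
  by rewrite -ltnS.
have eigen g : exists c, sigma_Lambda l0_neq0 l1_neq0 q g *m vpick U = c *: vpick U.
  by apply/vlineP; rewrite -vU; apply: Uinv; exact: memv_pick.
have [c e1] := eigen sigma1; have [d e2] := eigen sigma2.
apply: ne; rewrite sigma_Lambda_sigma1 in e1; rewrite sigma_Lambda_sigma2 in e2.
exact: sigma_common_eigenvector l0_neq0 l1_neq0 vN0 e1 e2.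
Qed.

(** The quadratic form in [l0] and [l1] is homogeneous of degree 2, so dividing by [l0 ^+ 2] leaves
    a polynomial in the ratio alone. *)
Lemma diag2_alphaP (K : fieldType) (l0 l1 : K) : l0 != 0 ->
  (exists alpha : K,
     diag2 l0 l1 = l0 *: diag2 1 alpha /\ alpha ^+ 2 - alpha + 1 = 0) <->
  l1 ^+ 2 - l0 * l1 + l0 ^+ 2 = 0.
Proof.
(* The lower right entry gives [l1 = l0 * a]; the other entries carry no information. *)
move=> l0N0; split=> [[a [/matrixP/(_ 1 1)]]|e].
  rewrite !mxE /= => -> ea.
  have -> : (l0 * a) ^+ 2 - l0 * (l0 * a) + l0 ^+ 2 = l0 ^+ 2 * (a ^+ 2 - a + 1).
    by ring.
  by rewrite ea mulr0.
exists (l1 / l0); split.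
  apply/matrixP => i j; rewrite !mxE.
  by case: (i == 0); case: (j == 0); rewrite ?mulr0 ?mulr1 // mulrC divfK.
have -> : (l1 / l0) ^+ 2 - l1 / l0 + 1 = (l1 ^+ 2 - l0 * l1 + l0 ^+ 2) / l0 ^+ 2.
  by field.
by rewrite e mul0r.
Qed.

Theorem theorem4 (R : realType) (q l0 l1 : complex R)
    (q_neq0 : q != 0) (l0_neq0 : l0 != 0) (l1_neq0 : l1 != 0) :
  subspace_irreducible (sigma_Lambda l0_neq0 l1_neq0 q) <->
  ~ (exists alpha : complex R,
       diag2 l0 l1 = l0 *: diag2 1 alpha /\ alpha ^+ 2 - alpha + 1 = 0).
Proof.
by rewrite (diag2_alphaP _ l0 l1 l0_neq0); exact: sigma_Lambda_irreducibleP.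
Qed.
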